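(* Let $\mathbb{F}_q$ be a finite field of odd characteristic and let $\mathcal{S}\subset\mathbb{F}_q[x]$ be a set of monic polynomials of degree two, regarded as an alphabet. Let $\mathcal{I}\subseteq\mathcal{S}^*$ be the language of all words $f_1f_2\cdots f_k\in\mathcal{S}^*$ ($k\ge 0$) such that the composition $f_1\circ f_2\circ\cdots\circ f_k$ is irreducible in $\mathbb{F}_q[x]$. Then $\mathcal{I}$ is a regular language.
   Context: $\mathcal{S}^*$ denotes the set of all finite words over the alphabet $\mathcal{S}$ (the free monoid on $\mathcal{S}$). A word $f_1\cdots f_k$ corresponds to the polynomial $f_1\circ\cdots\circ f_k$; the empty word corresponds to $x$. A language over a finite alphabet is regular if it is accepted by a deterministic finite automaton; equivalently, if it is obtained from finite languages by finitely many applications of union, concatenation and Kleene star. *)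

(* Defs.v *)
From HB Require Import structures.
From mathcomp Require Import all_boot all_order all_algebra.
From mathcomp Require Import finmap.

Set Implicit Arguments.
Unset Strict Implicit.
Unset Printing Implicit Defensive.

Import GRing.Theory.
Local Open Scope ring_scope.

Section Automata.

Variable A : finType.

Definition language := seq A -> Prop.

Record dfa := Dfa {
  dfa_state : finType;
  dfa_start : dfa_state;
  dfa_final : {set dfa_state};
  dfa_trans : dfa_state -> A -> dfa_state
}.

(* The automaton reads words from left to right. *)
Definition dfa_accept (M : dfa) (w : seq A) : bool :=
  foldl (@dfa_trans M) (dfa_start M) w \in dfa_final M.

Definition regular (L : language) : Prop :=
  exists M : dfa, forall w : seq A, L w <-> dfa_accept M w.

End Automata.

Section Composition.

Variable F : finFieldType.

(* [:: f1; ...; fk] is sent to f1 \Po (... \Po (fk \Po 'X)), that is to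
   f1(f2(...fk(x))): in mathcomp, p \Po q is p evaluated at q. *)
Definition word_comp (w : seq {poly F}) : {poly F} :=
  foldr (fun f g => f \Po g) 'X w.

(* The alphabet is the finite type of elements of S; a letter f : S stands for
   the polynomial val f. *)
Definition irreducible_language (S : {fset {poly F}}) : language S :=
  fun w => irreducible_poly (word_comp (map val w)).

End Composition.

(* Main.v *)
(* If [g] is monic irreducible of degree [n] over [F_q], q odd, with root
   [beta], and [f = (x - a)^2 + c], then [g o f] is irreducible iff [beta - c]
   is not a square in [F_q(beta)], iff its norm [(-1)^n g(c)] is not a square in
   [F_q].  Since irreducibility of [g o f] forces that of [g], irreducibility of
   [f_1 o ... o f_k] only depends on the values of the functions induced on
   [F_q] by the proper prefixes and on the parity of their degrees.  There are
   finitely many such functions, and they can be composed letter by letter, so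
   they are the states of an automaton. *)
Require Import Defs.
From mathcomp Require Import all_boot all_order all_algebra.
From mathcomp Require Import finmap.
From mathcomp Require Import all_fingroup all_solvable all_field.
From mathcomp Require Import ring zify.

Import GRing.Theory.
Local Open Scope ring_scope.

(** * Frobenius powers and the norm in a finite extension *)

Lemma card_finField_pnat (F K : finFieldType) (phi : {rmorphism F -> K}) :
  [pchar K].-nat #|F|.
Proof.
have [p p_pr pcharF] := finPcharP F.
have /(rmorph_pchar phi) pcharK := pcharF.
rewrite (eq_pnat _ (pcharf_eq pcharK)) -cardsT.
exact: abelem_pgroup (fin_ring_pchar_abelem pcharF).
Qed.

(** The power map with exponent [#|F|] is additive on [K], because [#|F|] is a power of the
    characteristic, and it fixes the coefficients, which come from [F]. *)
Lemma horner_map_Frobenius (F K : finFieldType) (phi : {rmorphism F -> K})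
    (p : {poly F}) (x : K) (i : nat) :
  (map_poly phi p).[x ^+ (#|F| ^ i)] = (map_poly phi p).[x] ^+ (#|F| ^ i).
Proof.
elim: i => [|i IHi]; first by rewrite expn0 !expr1.
rewrite expnSr !exprM -{}IHi; move: (x ^+ _) => {i}x.
elim/poly_ind: p => [|p c IHp]; first rewrite rmorph0 !horner0 expr0n.
  by rewrite gtn_eqF // (ltnW (card_finNzRing_gt1 F)).
rewrite rmorphD rmorphM /= map_polyX map_polyC !hornerE.
by rewrite exprDn_pchar ?card_finField_pnat // exprMn IHp -rmorphXn expf_card.
Qed.

Section Norm.

Context (F K : finFieldType) (pi : {rmorphism {poly F} -> K}) (h : {poly F}).
Hypotheses (pi_surj : forall x, exists p, pi p = x).
Hypotheses (h_monic : h \is monic) (pi_h : pi h = 0).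
Hypothesis card_K : #|K| = (#|F| ^ (size h).-1)%N.

Let phi : {rmorphism F -> K} := pi \o polyC.
Let n := (size h).-1.

(** The class of ['X] generates [K] over [F]. If it were fixed, all of [K] would be, giving a
    polynomial of degree q^d with q^n > q^d roots. *)
Lemma quotient_Frobenius_neq d : (0 < d < n)%N -> pi 'X ^+ (#|F| ^ d) != pi 'X.
Proof.
move=> /andP[d_gt0 d_lt_n]; apply/eqP => fixX.
have q_gt1 := card_finNzRing_gt1 F.
have fixK (x : K) : x ^+ (#|F| ^ d) = x.
  have [p <-] := pi_surj x.
  by rewrite poly_initial /horner_morph -horner_map_Frobenius fixX.
have qd_gt1 : (1 < #|F| ^ d)%N by rewrite -[1%N](expn0 #|F|) ltn_exp2l.
have szP : size ('X^(#|F| ^ d) - 'X : {poly K}) = (#|F| ^ d).+1.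
  by rewrite size_polyDl size_polyXn // size_polyN size_polyX.
have := @max_poly_roots _ ('X^(#|F| ^ d) - 'X) (enum K).
rewrite -size_poly_gt0 szP -cardE card_K enum_uniq => /(_ isT).
rewrite ltnS leq_exp2l // leqNgt d_lt_n => h0.
suff /h0/(_ isT) : all (root ('X^(#|F| ^ d) - 'X)) (enum K) by [].
by apply/allP => x _; rewrite rootE !hornerE fixK subrr.
Qed.

(* Over the quotient, [h] splits as the product of the
   [X - beta ^ (q ^ i)], where [beta] is the class of ['X]. *)
Lemma norm_quotient :
  pi ((-1) ^+ n * h`_0)%:P = pi 'X ^+ (\sum_(i < n) #|F| ^ i).
Proof.
pose rs := [seq pi 'X ^+ (#|F| ^ i) | i <- iota 0 n].
have rs_uniq : uniq rs.
  rewrite map_inj_in_uniq ?iota_uniq // => i j.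
  wlog ltij : i j / (i < j)%N => [wl i_n j_n eqij|].
    by case: (ltngtP i j) => // /wl ->.
  rewrite !mem_iota !add0n => /= i_n j_n eqij; have : (0 < j - i < n)%N.
    by rewrite subn_gt0 ltij (leq_ltn_trans (leq_subr _ _)).
  (* Raising the equality of the [i]-th and [j]-th conjugates to the power q^(n-i) makes [pi 'X] a
     fixed point of the power q^(j-i). *)
  move/quotient_Frobenius_neq/eqP=> []; symmetry.
  have XK : pi 'X ^+ (#|F| ^ n) = pi 'X by rewrite -card_K expf_card.
  rewrite -{1}XK -(subnKC (ltnW i_n)) expnD exprM eqij -exprM -expnD.
  rewrite addnBA ?(ltnW i_n) // -addnBAC ?(ltnW ltij) // addnC.
  by rewrite expnD exprM XK.
have hE : map_poly phi h = \prod_(z <- rs) ('X - z%:P).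
  rewrite [LHS](@all_roots_prod_XsubC _ _ rs) ?uniq_rootsE //.
  - by rewrite lead_coef_map (monicP h_monic) rmorph1 scale1r.
  - by rewrite size_map_poly size_map size_iota prednK //
    size_poly_gt0 monic_neq0.
  apply/allP => _ /mapP[i _ ->]; rewrite rootE horner_map_Frobenius.
  have := poly_initial pi h; rewrite /horner_morph pi_h => <-.
  by rewrite expr0n expn_eq0 gtn_eqF // (ltnW (card_finNzRing_gt1 F)).
have -> : pi ((-1) ^+ n * h`_0)%:P = (-1) ^+ n * (map_poly phi h)`_0.
  by rewrite coef_map /= -[pi _]/(phi _) rmorphM rmorphXn rmorphN1.
rewrite hE coef0_prod_XsubC size_map size_iota signrMK big_map.
by rewrite -prodrXr -(big_mkord xpredT (fun i => pi 'X ^+ (#|F| ^ i)))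
  /index_iota subn0.
Qed.

End Norm.

(** * Squares in finite fields and modulo an irreducible polynomial *)

(** Euler's criterion: if [x] is the [k]-th power of a generator of the cyclic unit group, of order
    2m, then 2m divides km, so [k] is even. *)
Lemma finField_sqrt (K : finFieldType) (x : K) (m : nat) :
  (m * 2)%N = #|K|.-1 -> x ^+ m = 1 -> exists y, x = y ^+ 2.
Proof.
move=> card_K xm1.
have m_gt0 : (0 < m)%N.
  by rewrite -(ltn_pmul2r (isT : 0 < 2)%N) card_K mul0n -subn1 subn_gt0
    card_finNzRing_gt1.
have x_unit : x \is a GRing.unit.
  by rewrite unitfE; apply: contra_eqN xm1 => /eqP->;
    rewrite expr0n gtn_eqF // eq_sym oner_eq0.
have /cyclicP[z zE] := field_unit_group_cyclic [set: {unit K}].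
have : FinRing.unit K x_unit \in <[z]>%g by rewrite -zE inE.
case/cycleP => k xE.
have : (z ^+ (k * m) == 1)%g.
  by rewrite expgM -xE -val_eqE /= FinRing.val_unitX /= xm1.
rewrite -order_dvdn /order -zE card_finField_unit -card_K mulnC dvdn_pmul2r //.
case/dvdnP => j kE; exists (val (z ^+ j)%g).
by rewrite -[LHS]/(val (FinRing.unit K x_unit)) xE kE expgM !FinRing.val_unitX.
Qed.

(* The class of ['X] modulo [h] has norm [s ^+ 2], so its power of exponent
   [(q ^ n - 1) / 2] is [s ^+ (q - 1) = 1], which makes it a square. *)
Lemma sqrt_mod_irreducible (F : finFieldType) (h : {poly F}) (s : F) :
  odd #|F| -> irreducible_poly h -> h \is monic ->
  s ^+ 2 = (-1) ^+ (size h).-1 * h`_0 -> exists c : {poly F}, h %| c ^+ 2 - 'X.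
Proof.
move=> oddF h_irr h_monic sE.
(* The power [s ^+ (q - 1)] is 1 only for nonzero [s]. If [s = 0], then [h] is associated to ['X]
   and [c = 0] works. *)
have [s0|s_neq0] := eqVneq s 0.
  have h0 : root h 0.
    by move/eqP: sE; rewrite s0 expr0n eq_sym mulf_eq0 signr_eq0 -horner_coef0.
  have X_h : 'X %| h by rewrite -['X]subr0 -polyC0 dvdp_XsubCl.
  exists 0; rewrite expr0n add0r dvdpNr.
  by have /andP[] : 'X %= h by apply: (apply_irredp h_irr); rewrite ?size_polyX.
have hI : monic_irreducible_poly h by [].
pose K : finFieldType := {poly %/ h with hI}.
pose pi : {rmorphism {poly F} -> K} := in_qpoly h.
have pi_eq0 p : (pi p == 0) = (h %| p).
  rewrite -val_eqE /= -Pdiv.IdomainMonic.modpE ?monic_mk_monic // mk_monicE //.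
have pi_surj (x : K) : exists p, pi p = x.
  exists (val x); apply: val_inj => /=.
  by rewrite Pdiv.CommonRing.rmodp_small // size_mk_monic.
have card_K : #|K| = (#|F| ^ (size h).-1)%N by exact: card_qfpoly.
have pi_h : pi h = 0 by apply/eqP; rewrite pi_eq0.
have := @norm_quotient F K pi h pi_surj h_monic pi_h card_K.
rewrite -sE => norm_X.
(* This is (q^n - 1)/2, factored so that the exponent of the norm can be applied first. *)
pose m := ((\sum_(i < (size h).-1) #|F| ^ i) * #|F|.-1./2)%N.
have [y yE] : exists y, pi 'X = y ^+ 2.
  have card_F : (#|F|.-1./2 * 2)%N = #|F|.-1.
    by case: #|F| oddF => //= q /negbTE q_even;
      rewrite muln2 halfK q_even subn0.
  apply: (@finField_sqrt _ _ m).
    by rewrite -mulnA card_F mulnC -predn_exp card_K.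
  rewrite exprM -norm_X -!rmorphXn /= -exprM mulnC card_F.
  have -> : s ^+ #|F|.-1 = 1.
    by apply: (mulIf s_neq0); rewrite mul1r -exprSr prednK ?expf_card //
      (ltnW (card_finNzRing_gt1 F)).
  exact: rmorph1.
have [c cE] := pi_surj y; exists c.
by rewrite -pi_eq0 rmorphB rmorphXn cE -yE subrr.
Qed.

(** * Irreducibility under substitution *)

(** A divisor [u] of [p] yields the divisor [u \Po q] of [p \Po q]. Degrees are multiplied by that
    of [q], which is positive, so proper divisors stay proper. *)
Lemma irreducible_comp (F : fieldType) (p q : {poly F}) :
  (1 < size q)%N -> irreducible_poly (p \Po q) -> irreducible_poly p.
Proof.
move=> q_gt1 [pq_gt1 pq_irr].
have q1_gt0 : (0 < (size q).-1)%N by rewrite -subn1 subn_gt0.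
have size_comp_eq1 (r : {poly F}) : (size (r \Po q) == 1%N) = (size r == 1%N).
  have [->|r_neq0] := eqVneq r 0; first by rewrite comp_poly0 size_poly0.
  have rq_neq0 : r \Po q != 0 by rewrite comp_poly_eq0.
  have := size_comp_poly r q.
  rewrite -!size_poly_gt0 in r_neq0 rq_neq0.
  by move: (size q).-1 (size r) (size (r \Po q)) q1_gt0 r_neq0 rq_neq0; nia.
have p_neq0 : p != 0.
  by apply: contraTneq pq_gt1 => ->; rewrite comp_poly0 size_poly0.
split=> [|u u_neq1 u_p].
  rewrite ltn_neqAle eq_sym -size_comp_eq1 gtn_eqF //.
  by rewrite size_poly_gt0.
have u_neq0 : u != 0 by apply: contraNneq p_neq0 => u0; rewrite -dvd0p -u0.
have := dvdp_comp_poly q u_p => uq_pq.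
have := pq_irr _ _ uq_pq; rewrite size_comp_eq1 => /(_ u_neq1).
rewrite -!dvdp_size_eqp // => /eqP /(congr1 predn).
rewrite !size_comp_poly => /eqP; rewrite eqn_pmul2r // => /eqP eq_size.
by rewrite -(prednK (_ : 0 < size u)%N) ?size_poly_gt0 // eq_size prednK //
  size_poly_gt0.
Qed.

Lemma irreducible_shift (F : fieldType) (p : {poly F}) (a : F) :
  irreducible_poly (p \Po ('X + a%:P)) <-> irreducible_poly p.
Proof.
split; first by apply: irreducible_comp; rewrite size_XaddC.
move=> p_irr; apply: (@irreducible_comp _ _ ('X - a%:P));
  rewrite ?size_XsubC //.
by rewrite -comp_polyA comp_polyD comp_polyX comp_polyC subrK comp_polyXr.
Qed.

(* [h(x^2)] divides [c(x^2)^2 - x^2 = (c(x^2) - x)(c(x^2) + x)]; if it were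
   irreducible it would divide one factor, hence by parity both, hence [2x]. *)
Lemma sqrt_mod_comp_reducible (F : fieldType) (h c : {poly F}) :
  2 != 0 :> F -> h %| c ^+ 2 - 'X -> ~ irreducible_poly (h \Po 'X^2).
Proof.
move=> two_neq0 h_c H_irr; set H := h \Po 'X^2 in H_irr.
have h_irr : irreducible_poly h.
  by apply: irreducible_comp H_irr; rewrite size_polyXn.
have HN : H \Po - 'X = H by rewrite -comp_polyA comp_Xn_poly sqrrN.
pose C := c \Po 'X^2.
have CN : C \Po - 'X = C by rewrite -comp_polyA comp_Xn_poly sqrrN.
have H_C : H %| (C - 'X) * (C + 'X).
  rewrite -subr_sqr; have := dvdp_comp_poly 'X^2 h_c.
  by rewrite comp_polyB rmorphXn comp_polyX.
have H_even : (H %| C - 'X) = (H %| C + 'X).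
  apply/idP/idP => /(dvdp_comp_poly (- 'X));
    by rewrite HN ?comp_polyB ?comp_polyD CN comp_polyX ?opprK.
have {H_C} [H1 H2] : H %| C - 'X /\ H %| C + 'X.
  case Hd: (H %| C - 'X); first by rewrite -H_even Hd.
  move: H_C; rewrite Gauss_dvdpr; first by rewrite -H_even Hd.
  by rewrite irreducible_poly_coprime // Hd.
have : H %| (2 : F) *: 'X.
  have -> : (2 : F) *: 'X = (C + 'X) - (C - 'X) by rewrite scaler_nat; ring.
  exact: dvdp_sub.
rewrite dvdpZr // => /dvdp_leq; rewrite polyX_eq0 size_polyX => /(_ isT).
have [h_gt1 _] := h_irr.
have := size_comp_poly h 'X^2; rewrite -/H size_polyXn.
by case: (size h) (size H) h_gt1 => [|[|a]] // [|[|[|b]]]//= _; lia.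
Qed.

(** * Norms and factorizations of h(x^2) *)

Section EvenNorm.

Context (F : fieldType).
Implicit Types u v p q : {poly F}.

(* The norm of [u] for the extension [F[x^2] \subset F[x]]. *)
Definition even_norm u : {poly F} := even_poly u ^+ 2 - 'X * odd_poly u ^+ 2.

(** With u = e(x^2) + x o(x^2), this is a difference of squares. The size and the leading
    coefficient of the norm are read off from it. *)
Lemma even_norm_comp u : even_norm u \Po 'X^2 = u * (u \Po - 'X).
Proof.
rewrite comp_polyB rmorphXn rmorphM rmorphXn /= comp_polyX.
rewrite -{3 4}(poly_even_odd u) comp_polyD comp_polyM comp_polyX -!comp_polyA.
rewrite comp_Xn_poly sqrrN; ring.
Qed.

Lemma size_even_norm u : size (even_norm u) = size u.
Proof.
have [->|u_neq0] := eqVneq u 0.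
  by rewrite /even_norm !linear0 expr0n mulr0 subr0.
have sz2 : size (- 'X : {poly F}) = 2 by rewrite size_polyN size_polyX.
have uN_neq0 : u \Po - 'X != 0 by rewrite comp_poly2_eq0.
have := even_norm_comp u => normE.
have N_neq0 : even_norm u != 0.
  by apply: contra_neq (mulf_neq0 u_neq0 uN_neq0) => N0;
    rewrite -normE N0 comp_poly0.
have := size_comp_poly (even_norm u) 'X^2.
rewrite normE size_mul // size_comp_poly2 // size_polyXn.
by rewrite -!size_poly_gt0 in u_neq0 N_neq0; move: u_neq0 N_neq0;
  case: (size u) (size (even_norm u)) => [|a] [|b] //=; lia.
Qed.

Lemma lead_coef_even_norm u :
  lead_coef (even_norm u) = (-1) ^+ (size u).-1 * lead_coef u ^+ 2.
Proof.
have := lead_coef_comp (even_norm u) (_ : 1 < size ('X^2 : {poly F}))%N.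
rewrite size_polyXn lead_coefXn expr1n mulr1 => <- //.
rewrite even_norm_comp lead_coefM lead_coef_comp ?size_polyN ?size_polyX //.
by rewrite lead_coefN lead_coefX mulrA -expr2 mulrC.
Qed.

Lemma comp_Xn_inj n : (0 < n)%N -> injective (fun p => p \Po 'X^n).
Proof.
move=> n_gt0 p q /eqP; rewrite -subr_eq0 -comp_polyB.
rewrite comp_poly_eq0 ?size_polyXn //.
by rewrite subr_eq0 => /eqP.
Qed.

Lemma coef0_even_norm u : (even_norm u)`_0 = u`_0 ^+ 2.
Proof.
rewrite coefB coefXM subr0 -!horner_coef0 horner_exp !horner_coef0.
by rewrite coef_even_poly.
Qed.

(** Otherwise [u] is coprime to [h], hence to [h ^+ 2], hence to its own divisor [u], so [u] is
    constant. *)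
Lemma irreducible_dvdp_sqr h u :
  irreducible_poly h -> size u != 1%N -> u %| h ^+ 2 -> h %| u.
Proof.
move=> h_irr u_neq1 u_h2; apply: contraNT u_neq1.
rewrite -irreducible_poly_coprime // => co_hu.
by rewrite -coprimepp (coprimep_dvdr u_h2) // coprimep_expl.
Qed.

(* [h ^+ 2] is the product of the norms of [u] and [v], and both are divisible
   by [h], so [h] is the norm of [u] up to a constant. *)
Lemma even_norm_reducible h u v :
  irreducible_poly h -> h \is monic -> h \Po 'X^2 = u * v ->
  (1 < size u)%N -> (1 < size v)%N ->
  exists s, s ^+ 2 = (-1) ^+ (size h).-1 * h`_0.
Proof.
move=> h_irr h_monic H_uv u_gt1 v_gt1.
have [h_neq0 [h_gt1 _]] := (irredp_neq0 h_irr, h_irr).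
have norm_uv : h ^+ 2 = even_norm u * even_norm v.
  apply: (@comp_Xn_inj 2) => //=; rewrite rmorphXn comp_polyM !even_norm_comp.
  by rewrite mulrACA -comp_polyM -H_uv -comp_polyA comp_Xn_poly sqrrN.
have h_dvd (w : {poly F}) :
    (1 < size w)%N -> even_norm w %| h ^+ 2 -> h %| even_norm w.
  by move=> w_gt1; apply: irreducible_dvdp_sqr;
    rewrite // size_even_norm gtn_eqF.
have h_u : h %| even_norm u by rewrite h_dvd // norm_uv dvdp_mulr.
have h_v : h %| even_norm v by rewrite h_dvd // norm_uv dvdp_mull.
have norm_neq0 (w : {poly F}) : (1 < size w)%N -> even_norm w != 0.
  by move=> w_gt1; rewrite -size_poly_gt0 size_even_norm ltnW.
have := dvdp_leq (norm_neq0 v v_gt1) h_v; rewrite size_even_norm => h_le_v.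
have := dvdp_leq (norm_neq0 u u_gt1) h_u; rewrite size_even_norm => h_le_u.
(* The degrees of the two norms add up to twice that of [h] and neither is smaller than it, so both
   are equal to it. *)
have size_u : size u = size h.
  have := congr1 (fun p : {poly F} => size p) norm_uv.
  rewrite /= expr2 !size_mul ?norm_neq0 // !size_even_norm.
  by move: (size h) (size u) (size v) h_gt1 h_le_u h_le_v; lia.
have : h %= even_norm u by rewrite -dvdp_size_eqp // size_even_norm size_u.
(* Comparing constant coefficients, after matching leading ones, makes (-1)^n times the constant
   coefficient of [h] the square of that of [u] divided by [lead_coef u]. *)
move/eqp_eq => /(congr1 (fun p : {poly F} => p`_0)).
rewrite !coefZ (monicP h_monic) mul1r coef0_even_norm lead_coef_even_norm.
rewrite size_u => h0E.
have lu_neq0 : lead_coef u != 0 by rewrite lead_coef_eq0 -size_poly_gt0 ltnW.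
exists (u`_0 / lead_coef u); rewrite expr_div_n -h0E.
by field.
Qed.

End EvenNorm.

(** * Irreducibility criterion for composition with a monic quadratic *)

Lemma irreducible_comp_sqr (F : finFieldType) (h : {poly F}) :
  odd #|F| -> 2 != 0 :> F -> irreducible_poly h -> h \is monic ->
  irreducible_poly (h \Po 'X^2) <->
    ~ exists s, s ^+ 2 = (-1) ^+ (size h).-1 * h`_0.
Proof.
move=> oddF two_neq0 h_irr h_monic; split=> [H_irr [s sE]|not_sqr].
  have [c h_c] := sqrt_mod_irreducible _ _ _ oddF h_irr h_monic sE.
  exact: sqrt_mod_comp_reducible two_neq0 h_c H_irr.
have [h_gt1 _] := h_irr.
have size_H : (size (h \Po 'X^2)).-1 = ((size h).-1 * 2)%N.
  by rewrite size_comp_poly size_polyXn.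
have H_neq0 : h \Po 'X^2 != 0.
  by rewrite comp_poly_eq0 ?size_polyXn ?irredp_neq0.
split=> [|u u_neq1 /dvdpP[v H_vu]].
  by move: (size h) (size (_ \Po _)) h_gt1 size_H; lia.
have [v_neq0 u_neq0] : v != 0 /\ u != 0.
  by apply/andP; rewrite -negb_or -mulf_eq0 -H_vu.
have [v1|v_neq1] := eqVneq (size v) 1%N.
  by rewrite -dvdp_size_eqp H_vu ?dvdp_mull // size_mul // v1.
rewrite -!size_poly_gt0 in v_neq0 u_neq0.
case: not_sqr; apply: (even_norm_reducible _ _ _ _ h_irr h_monic H_vu).
  by rewrite ltn_neqAle eq_sym v_neq1.
by rewrite ltn_neqAle eq_sym u_neq1.
Qed.

(** Completing the square: [a] is the critical point of [f], and f = (x - a)^2 + f(a). *)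
Lemma monic_quadratic_vertexE (F : fieldType) (f : {poly F}) :
  2 != 0 :> F -> f \is monic -> size f = 3%N ->
  let a := - f`_1 / 2 in f = ('X + f.[a]%:P) \Po 'X^2 \Po ('X + (- a)%:P).
Proof.
move=> two_neq0 f_monic f_size a.
have f2 : f`_2 = 1 by have := monicP f_monic; rewrite /lead_coef f_size.
have f1 : f`_1 = - (a * 2) by rewrite divfK // opprK.
clearbody a.
have fE : f = 'X^2 - (a * 2)%:P * 'X + (f`_0)%:P.
  rewrite -[LHS]coefK poly_def f_size !big_ord_recl big_ord0 /= f1 f2.
  by rewrite -!mul_polyC polyCN polyC1 expr0 expr1; ring.
have -> : f.[a] = f`_0 - a ^+ 2 by rewrite [in LHS]fE !hornerE; ring.
rewrite -comp_polyA comp_polyD comp_polyX comp_polyC comp_Xn_poly [LHS]fE.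
rewrite !(polyCB, polyCM, polyCN, rmorphXn); ring.
Qed.

(** With h = g(x + c), completing the square gives g(f(x)) = h((x - a)^2). Translations preserve
    irreducibility, and the constant coefficient of [h] is g(c). *)
Lemma irreducible_comp_monic_quadratic (F : finFieldType) (g f : {poly F}) :
  odd #|F| -> 2 != 0 :> F -> irreducible_poly g -> g \is monic ->
  f \is monic -> size f = 3%N ->
  irreducible_poly (g \Po f) <->
    ~ exists s, s ^+ 2 = (-1) ^+ (size g).-1 * g.[f.[- f`_1 / 2]].
Proof.
move=> oddF two_neq0 g_irr g_monic f_monic f_size.
set c := f.[_]; pose h := g \Po ('X + c%:P).
have h_irr : irreducible_poly h by apply/irreducible_shift.
have h_monic : h \is monic.
  by rewrite monicE lead_coef_comp ?size_XaddC //
    lead_coefXaddC expr1n mulr1 -monicE.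
have := irreducible_comp_sqr _ _ oddF two_neq0 h_irr h_monic.
rewrite size_comp_poly2 ?size_XaddC // -horner_coef0 horner_comp !hornerE.
by rewrite {1}(monic_quadratic_vertexE _ _ two_neq0 f_monic f_size) -/c
  !comp_polyA irreducible_shift.
Qed.

(** * Words and the automaton *)

(** Each newly read letter becomes the innermost polynomial, so the inductions below remove the last
    letter. *)
Lemma word_comp_rcons (F : finFieldType) (w : seq {poly F}) (f : {poly F}) :
  word_comp (rcons w f) = word_comp w \Po f.
Proof.
elim: w => [|g w IHw] /=; first by rewrite comp_polyX comp_polyXr.
by rewrite IHw comp_polyA.
Qed.

Lemma word_comp_monic (F : finFieldType) (w : seq {poly F}) :
  {in w, forall f, f \is monic /\ size f = 3%N} -> word_comp w \is monic.
Proof.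
elim/last_ind: w => [|w f IHw] Hw; first exact: monicX.
have [|f_monic f_size] := Hw f; first by rewrite mem_rcons mem_head.
rewrite word_comp_rcons monicE lead_coef_comp ?f_size //
  (monicP f_monic) expr1n mulr1 -monicE.
by apply: IHw => g g_w; apply: Hw; rewrite mem_rcons inE g_w orbT.
Qed.

Section Automaton.

Context (F : finFieldType) (S : {fset {poly F}}).

(* After reading [w], with [g = word_comp w] of degree [n], the state is
   (the function of [g], [(-1) ^ n], whether [g] is irreducible). *)
Definition irreducible_state : finType := ({ffun F -> F} * F * bool)%type.

(** Each letter doubles the degree, hence [e ^+ 2]. The flag is updated by the square criterion,
    whose value of [g] at the critical value of [f] is looked up in the stored function. *)
Definition irreducible_step (q : irreducible_state) (f : S) :
    irreducible_state :=
  let: (g, e, b) := q in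
  ([ffun c => g (val f).[c]], e ^+ 2,
   b && ~~ [exists s, s ^+ 2 == e * g (val f).[- (val f)`_1 / 2]]).

Definition irreducible_dfa : dfa S :=
  @Dfa S irreducible_state ([ffun c => c], -1, true) [set q | q.2]
    irreducible_step.

Hypothesis hS : forall f : {poly F}, f \in S -> f \is monic /\ size f = 3%N.
Hypotheses (oddF : odd #|F|) (two_neq0 : 2 != 0 :> F).

Lemma irreducible_dfa_run (w : seq S) (g := word_comp (map val w)) :
  foldl irreducible_step (dfa_start irreducible_dfa) w =
    ([ffun c => g.[c]], (-1) ^+ (size g).-1, irreducibleb g).
Proof.
rewrite {}/g; elim/last_ind: w => [|w f IHw].
  rewrite /= size_polyX expr1; congr (_, _, _).
    by apply/ffunP => c; rewrite !ffunE hornerX.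
  apply/esym/irreducibleP; rewrite -[X in irreducible_poly X]addr0 -polyC0.
  exact: irredp_XaddC.
have [f_monic f_size] := hS _ (fsvalP f).
rewrite foldl_rcons {}IHw map_rcons word_comp_rcons /=.
have : word_comp (map val w) \is monic.
  by apply: word_comp_monic => _ /mapP[f' _ ->]; apply: hS (fsvalP f').
move: (word_comp _) => g g_monic; congr (_, _, _).
- by apply/ffunP => c; rewrite !ffunE horner_comp.
- by rewrite size_comp_poly f_size exprM.
(* A reducible prefix stays reducible under any further letter, so a false flag never has to be
   reset. *)
rewrite ffunE; have [g_irr|g_red] := irreducibleP g; last first.
  by apply/esym/irreducibleP => /irreducible_comp; rewrite f_size => /(_ isT).
apply/negP/irreducibleP => [not_sqr|/irreducible_comp_monic_quadratic H].
  apply/irreducible_comp_monic_quadratic => // -[s sE].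
  by apply: not_sqr; apply/existsP; exists s; apply/eqP.
by case/existsP => s /eqP sE; apply: H => //; exists s.
Qed.

End Automaton.

Theorem theorem3p8 (F : finFieldType) (p : nat) (hp : p \in [pchar F])
    (hodd : odd p) (S : {fset {poly F}})
    (hS : forall f : {poly F}, f \in S -> f \is monic /\ size f = 3%N) :
  regular (@irreducible_language F S).
Proof.
have two_neq0 : 2 != 0 :> F.
  rewrite -(dvdn_pcharf hp); apply: contraTN hodd.
  move/(dvdn_leq (isT : 0 < 2)%N).
  by have := pcharf_prime hp; case: p {hp} => [|[|[]]].
(* The additive group of [F] is an elementary abelian [p]-group, so [#|F|] is a power of the odd
   [p]. *)
have oddF : odd #|F|.
  have : p.-nat #|F|.
    rewrite -cardsT; exact: abelem_pgroup (fin_ring_pchar_abelem hp).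
  case/p_natP => k ->; by rewrite oddX hodd orbT.
exists (irreducible_dfa F S) => w.
rewrite /dfa_accept irreducible_dfa_run // inE.
exact: rwP (irreducibleP _).
Qed.
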